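(* Let $K$ be a number field, $A=\mathfrak o_K$, and let $C(X)=X^3+uX+v\in A[X]$ be irreducible with Galois group $\mathfrak S_3$ over $K$, i.e. its discriminant $\Delta=-4u^3-27v^2$ is not a square in $A$. Let $(U_n)$ be any sequence of elements of $A$ with $U_{n+3}+uU_{n+1}+vU_n=0$ for all $n$. For every nonzero prime $\mathcal P$ of $A$ not ramified (i.e. $\Delta\notin\mathcal P$), with $p=N(\mathcal P)$, let $R_p(X)=aX^2+bX+c$ ($a,b,c\in A$, depending on $\mathcal P$) be the remainder of the division of $X^p$ by $C(X)$; then $U_p\equiv aU_2+bU_1+cU_0\pmod{\mathcal P}$, and: - always $3c\equiv 2ua\pmod{\mathcal P}$; - if $\mathcal P\in\mathbb P_1$, then $U_p\equiv U_1\pmod{\mathcal P}$; - if $\mathcal P\in\mathbb P_3$, then $\Delta a^2-9u^2\equiv0$, $\Delta(b^2+b)-(u^3+27v^2)\equiv0$, $\Delta c^2-4u^4\equiv0 \pmod{\mathcal P}$; - if $\mathcal P\in\mathbb P_2$, then $\Delta a^3-9u^2a-27v\equiv0$, $\Delta b^3+3u^3b-u^3\equiv0$, $\Delta c^3-4u^4c-8u^3v\equiv0\pmod{\mathcal P}$.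
   Context: $E$ is the splitting field of $C$ over $K$, $B=\mathfrak o_E$, $N(\mathcal P)=|A/\mathcal P|$. For $f\in\{1,2,3\}$, $\mathbb P_f$ is the set of nonzero prime ideals $\mathcal P$ of $A$ with $\Delta\notin\mathcal P$ such that some prime $Q$ of $B$ above $\mathcal P$ has Frobenius $\mathrm{Frob}_Q\in G(E/K)\simeq\mathfrak S_3$ of order $f$, where $\mathrm{Frob}_Q(x)\equiv x^{N(\mathcal P)}\pmod Q$ for all $x\in B$. *)

(* Defs.v *)
From HB Require Import structures.
From mathcomp Require Import all_boot all_order all_fingroup all_algebra.
From mathcomp Require Import all_solvable all_field finmap.
From mathcomp Require Import boolp classical_sets cardinality.

Set Implicit Arguments.
Unset Strict Implicit.
Unset Printing Implicit Defensive.

Import GRing.Theory.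
Local Open Scope ring_scope.
Local Open Scope quotient_scope.

Definition algebraic_integer (F : fieldType) : {pred F} :=
  fun x => `[< integralOver (intr : int -> F) x >].

Arguments algebraic_integer F : clear implicits.

Lemma algebraic_integer_subring (F : fieldType) :
  subring_closed (algebraic_integer F).
Proof.
split=> [|x y /asboolP xi /asboolP yi|x y /asboolP xi /asboolP yi].
- exact/asboolP/integral1.
- exact/asboolP/integral_sub.
- exact/asboolP/integral_mul.
Qed.

HB.instance Definition _ (F : fieldType) :=
  GRing.isSubringClosed.Build F (algebraic_integer F)
    (algebraic_integer_subring F).

(* For a number field F, this is its maximal order. *)
Record ringOfIntegers (F : fieldType) := RingOfIntegers {
  oval : F;
  ovalP : oval \in algebraic_integer F
}.

HB.instance Definition _ (F : fieldType) := [isSub for @oval F].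
HB.instance Definition _ (F : fieldType) :=
  [Choice of ringOfIntegers F by <:].
HB.instance Definition _ (F : fieldType) :=
  [SubChoice_isSubComNzRing of ringOfIntegers F by <:].

Lemma algebraic_integer_rmorph (F L : fieldType) (h : {rmorphism F -> L})
  (x : ringOfIntegers F) : h (oval x) \in algebraic_integer L.
Proof.
have /asboolP[p p_mon px0] := ovalP x.
apply/asboolP; exists p => //.
have -> : map_poly (intr : int -> L) p = map_poly h (map_poly intr p).
  by rewrite -map_poly_comp; apply: eq_map_poly => n; rewrite /= rmorph_int.
by rewrite fmorph_root.
Qed.

Definition integers_map (F L : fieldType) (h : {rmorphism F -> L})
  (x : ringOfIntegers F) : ringOfIntegers L :=
  RingOfIntegers (algebraic_integer_rmorph h x).

(* |R / I|; the value is 0 when R / I is infinite. *)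
Definition ideal_norm (R : comNzRingType) (I : prime_idealr R) : nat :=
  #|` fset_set [set: {ideal_quot I}]%classic |%fset.

Definition nonzero_ideal (R : comNzRingType) (I : prime_idealr R) : Prop :=
  exists2 x : R, x \in I & x != 0.

Definition cubic (R : comNzRingType) (u v : R) : {poly R} :=
  'X^3 + u *: 'X + v%:P.

Definition cubic_disc (R : comNzRingType) (u v : R) : R :=
  - 4%:R * u ^+ 3 - 27%:R * v ^+ 2.

Section Frobenius.
Variables (K : fieldExtType rat) (E : splittingFieldType K).
Notation A := (ringOfIntegers K).
Notation B := (ringOfIntegers E).

Definition lies_above (P : prime_idealr A) (Q : prime_idealr B) : Prop :=
  forall x : A, (integers_map (in_alg E) x \in Q) = (x \in P).

Definition is_Frobenius (P : prime_idealr A) (Q : prime_idealr B)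
    (s : gal_of {:E}) : Prop :=
  s \in 'Gal({:E} / 1)%g /\
  forall x : B, integers_map (gal_repr s) x = x ^+ ideal_norm P %[ mod_ideal Q].

(* The set P_f of the unramified (Delta \notin P) nonzero primes whose
   Frobenius has order f. *)
Definition frobenius_primes (Delta : A) (f : nat) (P : prime_idealr A) : Prop :=
  [/\ nonzero_ideal P, Delta \notin P &
      exists (Q : prime_idealr B) (s : gal_of {:E}),
        [/\ lies_above P Q, is_Frobenius P Q s & #[s]%g = f]].

End Frobenius.
Arguments frobenius_primes {K} E Delta f P.

(* Main.v *)
Require Import Defs.
From HB Require Import structures.
From mathcomp Require Import all_boot all_order all_fingroup all_algebra.
From mathcomp Require Import all_solvable all_field.
From mathcomp Require Import boolp classical_sets cardinality finmap ring.

(* A prime [Q] above [P] reduces the roots r1, r2, r3 of [C] to distinct elements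
   of the domain B/Q, and there R_p(r_i) = r_i^p = Frob_Q(r_i). So R_p is the
   quadratic polynomial interpolating the permutation of the roots induced by the
   Frobenius: the identity, a 3-cycle or a transposition according to the order of
   Frob_Q, and the congruences are the resulting polynomial identities in the r_i.
   The relation 3c = 2ua needs no [Q]: in a splitting field of [C] over the finite
   field A/P, the sum of the R_p(r_i) is 3c - 2ua and equals (r1 + r2 + r3)^p = 0.
   That A/P is finite (so that p is a power of its characteristic l) holds because
   every element of [A] is a root of a primitive integer polynomial of degree at
   most [K : Q], hence its class is a root of one of finitely many nonzero
   polynomials over F_l. *)

Set Implicit Arguments.
Unset Strict Implicit.
Unset Printing Implicit Defensive.

Import GRing.Theory.
Local Open Scope ring_scope.
Local Open Scope quotient_scope.

(** * Quadratic interpolation of a permutation of the roots of a cubic *)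

Section QuadraticInterpolation.
Variables (T : comNzRingType) (a b c r1 r2 r3 : T).
Hypothesis domT : GRing.integral_domain_axiom T.
Hypothesis r123 : r1 + r2 + r3 = 0.
Let u := r1 * r2 + r1 * r3 + r2 * r3.
Let v := - (r1 * r2 * r3).
Let q (x : T) := a * x ^+ 2 + b * x + c.
Let V := (r1 - r2) * (r1 - r3) * (r2 - r3).

Let r3E : r3 = - r1 - r2.
Proof. by apply/eqP; rewrite -subr_eq0 -r123; apply/eqP; ring. Qed.

Lemma cubic_disc_vandermonde : cubic_disc u v = V ^+ 2.
Proof. rewrite /cubic_disc /u /v /V r3E; ring. Qed.

Lemma trace_quadratic : q r1 + q r2 + q r3 = 3%:R * c - 2%:R * u * a.
Proof. rewrite /q /u r3E; ring. Qed.

(** Cramer's rule for the system [a * r ^+ 2 + b * r + c = q r] at the three roots; its Vandermonde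
    determinant is [V]. *)
Let cramer_a :
  V * a = q r1 * (r2 - r3) - q r2 * (r1 - r3) + q r3 * (r1 - r2).
Proof. rewrite /V /q; ring. Qed.

Let cramer_b : V * b = - q r1 * (r2 ^+ 2 - r3 ^+ 2)
  + q r2 * (r1 ^+ 2 - r3 ^+ 2) - q r3 * (r1 ^+ 2 - r2 ^+ 2).
Proof. rewrite /V /q; ring. Qed.

Let cramer_c : V * c = q r1 * (r2 * r3 * (r2 - r3))
  - q r2 * (r1 * r3 * (r1 - r3)) + q r3 * (r1 * r2 * (r1 - r2)).
Proof. rewrite /V /q; ring. Qed.

Lemma quadratic_fixing_roots : V != 0 -> q r1 = r1 -> q r2 = r2 -> q r3 = r3 ->
  [/\ a = 0, b = 1 & c = 0].
Proof.
move=> /negPf nzV q1 q2 q3.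
have V_inj x : V * x = 0 -> x = 0 by move=> /domT; rewrite nzV => /eqP.
split; apply/eqP; rewrite -subr_eq0; apply/eqP/V_inj.
- rewrite subr0 cramer_a q1 q2 q3; ring.
- rewrite mulrBr cramer_b q1 q2 q3 /V; ring.
- rewrite subr0 cramer_c q1 q2 q3; ring.
Qed.

(** Cramer's formulas turn [V * a], [V * b], [V * c] into polynomials in the roots (the first is
    [- 3%:R * u]), and [D] is [V ^+ 2], so nothing has to be cancelled. *)
Lemma quadratic_cycling_roots : q r1 = r2 -> q r2 = r3 -> q r3 = r1 ->
  let D := cubic_disc u v in
  [/\ D * a ^+ 2 - 9%:R * u ^+ 2 = 0,
      D * (b ^+ 2 + b) - (u ^+ 3 + 27%:R * v ^+ 2) = 0
    & D * c ^+ 2 - 4%:R * u ^+ 4 = 0].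
Proof.
move=> q1 q2 q3 D; rewrite /D cubic_disc_vandermonde.
(* [V * b] and [V * b + V] are [3%:R * v] plus one of the two cyclic sums of the [ri ^+ 2 * rj]; a
   transposition of the roots exchanges them, so their product is symmetric. *)
have -> : V ^+ 2 * (b ^+ 2 + b) = (V * b) ^+ 2 + V * (V * b) by ring.
split; rewrite -?exprMn ?cramer_a ?cramer_b ?cramer_c q1 q2 q3 /V /u /v r3E; ring.
Qed.

(** The fixed root [r1] governs the interpolant: with [C'] the derivative of the cubic, multiplying
    [a], [b], [c] by [C' r1] gives [3%:R * r1], [- u], [2%:R * u * r1]. *)
Lemma quadratic_swapping_roots : r2 - r3 != 0 ->
  q r1 = r1 -> q r2 = r3 -> q r3 = r2 ->
  let D := cubic_disc u v in
  [/\ D * a ^+ 3 - 9%:R * u ^+ 2 * a - 27%:R * v = 0,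
      D * b ^+ 3 + 3%:R * u ^+ 3 * b - u ^+ 3 = 0
    & D * c ^+ 3 - 4%:R * u ^+ 4 * c - 8%:R * u ^+ 3 * v = 0].
Proof.
move=> /negPf nz23 q1 q2 q3 D.
pose C' x := 3%:R * x ^+ 2 + u.
have bE : b = a * r1 - 1.
  (* The difference [q r2 - q r3] is [r2 - r3] times [b - a * r1], because [r2 + r3 = - r1]. *)
  have /domT : (r2 - r3) * (b - (a * r1 - 1)) = 0.
    have -> : (r2 - r3) * (b - (a * r1 - 1)) = q r2 - q r3 - (r3 - r2).
      by rewrite /q r3E; ring.
    by rewrite q2 q3 subrr.
  by rewrite nz23 subr_eq0 => /eqP.
have aC' : a * C' r1 - 3%:R * r1 = 0.
  have -> : a * C' r1 - 3%:R * r1 = (q r1 - r1) - (q r2 - r3).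
    by rewrite /q /C' /u bE r3E; ring.
  by rewrite q1 q2 !subrr.
have bC' : b * C' r1 + u = 0.
  have -> : b * C' r1 + u = r1 * (a * C' r1 - 3%:R * r1) by rewrite bE /C'; ring.
  by rewrite aC' mulr0.
have cE : c = a * (u + r1 ^+ 2) - r1.
  apply/eqP; rewrite -subr_eq0; apply/eqP.
  have -> : c - (a * (u + r1 ^+ 2) - r1) = q r2 - r3.
    by rewrite /q bE /u r3E; ring.
  by rewrite q2 subrr.
have cC' : c * C' r1 - 2%:R * u * r1 = 0.
  have -> : c * C' r1 - 2%:R * u * r1
          = (u + r1 ^+ 2) * (a * C' r1 - 3%:R * r1) by rewrite cE /C'; ring.
  by rewrite aC' mulr0.
(* In each case the left-hand side is, up to sign, the norm of the linear
   expression in [a], [b] or [c] that vanishes at [r1]. *)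
split.
- transitivity (- ((a * C' r1 - 3%:R * r1) * (a * C' r2 - 3%:R * r2)
                   * (a * C' r3 - 3%:R * r3))); last by rewrite aC' !mul0r oppr0.
  by rewrite /D /cubic_disc /C' /u /v r3E; ring.
- transitivity (- ((b * C' r1 + u) * (b * C' r2 + u) * (b * C' r3 + u)));
    last by rewrite bC' !mul0r oppr0.
  by rewrite /D /cubic_disc /C' /u /v r3E; ring.
- transitivity (- ((c * C' r1 - 2%:R * u * r1) * (c * C' r2 - 2%:R * u * r2)
                   * (c * C' r3 - 2%:R * u * r3)));
    last by rewrite cC' !mul0r oppr0.
  by rewrite /D /cubic_disc /C' /u /v r3E; ring.
Qed.

End QuadraticInterpolation.

(** * The cubic, its remainders and the recurrence *)

Lemma size_cubic (R : comNzRingType) (u v : R) : size (cubic u v) = 4%N.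
Proof.
rewrite /cubic -addrA size_polyDl size_polyXn //.
rewrite (leq_ltn_trans (size_polyD _ _)) // gtn_max.
rewrite (leq_ltn_trans (size_scale_leq _ _)) ?size_polyX //.
by rewrite (leq_ltn_trans (size_polyC_leq1 _)).
Qed.

Lemma monic_cubic (R : comNzRingType) (u v : R) : cubic u v \is monic.
Proof.
by rewrite monicE lead_coefE size_cubic /cubic !coefE /= mulr0 !addr0.
Qed.

Lemma map_cubic (R S : comNzRingType) (f : {rmorphism R -> S}) (u v : R) :
  map_poly f (cubic u v) = cubic (f u) (f v).
Proof. by rewrite /cubic !rmorphD /= map_polyXn map_polyZ map_polyX map_polyC. Qed.

Lemma poly_size3 (R : comNzRingType) (p : {poly R}) : (size p <= 3)%N ->
  p = p`_2 *: 'X^2 + p`_1 *: 'X + (p`_0)%:P.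
Proof.
move=> sp; apply/polyP => i; rewrite !coefE.
case: i => [|[|[|i]]] /=; rewrite ?mulr0 ?mulr1 ?addr0 ?add0r //.
by rewrite nth_default // (leq_trans sp).
Qed.

Lemma horner_rmodp_root (R S : comNzRingType) (f : {rmorphism R -> S})
    (d p : {poly R}) (x : S) : d \is monic -> root (map_poly f d) x ->
  (map_poly f (Pdiv.Ring.rmodp p d)).[x] = (map_poly f p).[x].
Proof.
move=> d_mon /rootP dx0; rewrite [in RHS](Pdiv.RingMonic.rdivp_eq d_mon p).
by rewrite rmorphD rmorphM /= hornerD hornerM dx0 mulr0 add0r.
Qed.

(** By the recurrence, the linear functional sending ['X^i] to [U i] kills every ['X^k * C], hence
    every multiple of [C]; so it agrees on ['X^n] and on its remainder. *)
Lemma linear_recurrence_rmodp (R : comNzRingType) (u v : R) (U : nat -> R) :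
  (forall n, U n.+3 + u * U n.+1 + v * U n = 0) ->
  forall (n : nat) (a b c : R),
  Pdiv.Ring.rmodp 'X^n (cubic u v) = a *: 'X^2 + b *: 'X + c%:P ->
  U n = a * U 2%N + b * U 1%N + c * U 0%N.
Proof.
move=> hU n a b c Rn; set C := cubic u v in Rn.
have eqX := Pdiv.RingMonic.rdivp_eq (monic_cubic u v) 'X^n.
set q := Pdiv.CommonRing.rdivp _ _ in eqX.
(* The functional [L] only reads coefficients below [N]; this bound exceeds [n] and the degree of
   [q * C], so nothing is lost. *)
pose N := (n + size q).+3.
pose L (p : {poly R}) := \sum_(i < N) p`_i * U i.
have LD p1 p2 : L (p1 + p2) = L p1 + L p2.
  by rewrite /L -big_split /=; apply: eq_bigr => i _; rewrite coefD mulrDl.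
have LZ k p1 : L (k *: p1) = k * L p1.
  by rewrite /L mulr_sumr; apply: eq_bigr => i _; rewrite coefZ mulrA.
have L0 : L 0 = 0 by rewrite -(scale0r 0) LZ mul0r.
have LX k : (k < N)%N -> L 'X^k = U k.
  move=> kN; rewrite /L (bigD1 (Ordinal kN)) //= coefXn eqxx mul1r big1 ?addr0 //.
  by move=> i /negPf ik; rewrite coefXn -[(_ == _)]/(i == Ordinal kN) ik mul0r.
have LC k : (k < size q)%N -> L ('X^k * C) = 0.
  move=> kq; have kN j : (j < 4)%N -> (k + j < N)%N.
    by move=> j4; rewrite /N -addn3 -addSn leq_add // (leq_trans kq) ?leq_addl.
  have -> : 'X^k * C = 'X^(k + 3) + u *: 'X^(k + 1) + v *: 'X^(k + 0).
    rewrite /C /cubic !mulrDr -exprD -scalerAr -exprSr addn1 addn0.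
    by rewrite mulrC mul_polyC.
  by rewrite !LD !LZ !LX ?kN // addn3 addn1 addn0.
have Lq : L (q * C) = 0.
  rewrite -[q]coefK poly_def mulr_suml.
  apply: (big_ind (fun p => L p = 0)) => // [p1 p2 p10 p20|i _].
    by rewrite LD p10 p20 addr0.
  by rewrite -scalerAl LZ LC ?mulr0.
have := congr1 L eqX; rewrite LD Lq add0r LX ?ltnS ?leqW ?leq_addr // => ->.
rewrite [Pdiv.CommonRing.rmodp _ _]Rn !LD !LZ LX // -['X]expr1 LX //.
by rewrite -alg_polyC LZ -(expr0 'X) LX.
Qed.

(** * Finiteness of the residue ring of [P] *)

Lemma pi_ideal_eq0 (R : comNzRingType) (I : idealr R) (x : R) :
  (\pi_{ideal_quot I} x == 0) = (x \in I).
Proof. by rewrite -[x in RHS]subr0 Quotient.idealrBE rmorph0. Qed.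

(** Each root splits off a linear factor and lowers the size; in a domain every other root is a root
    of the cofactor. The domain axiom is a hypothesis because residue rings are handled as plain
    commutative rings. *)
Lemma roots_in_seq (T : comNzRingType) (g : {poly T}) :
  GRing.integral_domain_axiom T -> g != 0 ->
  exists s : seq T, forall x, root g x -> x \in s.
Proof.
move=> domT; have [m] := ubnP (size g).
elim: m => // m IHm in g *; rewrite ltnS => sg nzg.
have [[r /factor_theorem[h gE]]|noroot] := pselect (exists r, root g r); last first.
  by exists [::] => x gx; case: noroot; exists x.
have nzh : h != 0 by apply: contraNneq nzg => h0; rewrite gE h0 mul0r.
have [|s hs] := IHm h _ nzh.
  by apply: leq_trans sg; rewrite gE size_Mmonic ?monicXsubC // size_XsubC addn2.
exists (r :: s) => x; rewrite gE rootE hornerM hornerXsubC inE orbC.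
by move=> /eqP/domT/orP[hx0|]; [rewrite hs | rewrite subr_eq0 => ->; rewrite orbT].
Qed.

(** The minimal polynomial over the rationals, cleared of denominators and content. The size bound
    is uniform in [x], and primitivity keeps the polynomial nonzero modulo every prime. *)
Lemma primitive_annihilator (K : fieldExtType rat) (x : ringOfIntegers K) :
  exists q : {poly int}, [/\ zcontents q = 1, (size q <= (\dim {:K}).+1)%N
    & (map_poly intr q).[x] = 0].
Proof.
have /polyOver1P[q0 q0E] := minPolyOver 1%AS (oval x).
have [q1 [a nza q1E]] := rat_poly_scale q0.
have sq1 : size q1 = (adjoin_degree 1 (oval x)).+1.
  rewrite -size_minPoly q0E q1E size_map_poly size_scale ?invr_eq0 ?intr_eq0 //.
  by rewrite size_map_inj_poly // => i j /eqP; rewrite eqr_int => /eqP.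
have nzq1 : q1 != 0 by rewrite -size_poly_eq0 sq1.
exists (zprimitive q1); split; first by rewrite zcontents_primitive nzq1.
  rewrite size_zprimitive sq1 ltnS adjoin_degreeE dimv1 divn1.
  exact/dimvS/subvf.
have qx0 : (map_poly (in_alg K \o intr) (zprimitive q1)).[oval x] = 0.
  apply/eqP; have /eqP := minPolyxx 1 (oval x); rewrite q0E q1E.
  rewrite {1}(zpolyEprim q1) !map_polyZ /= -map_poly_comp /= scalerA hornerZ.
  rewrite !mulf_eq0 !scaler_eq0 oner_eq0 !orbF invr_eq0 !intr_eq0.
  by rewrite (negPf nza) zcontents_eq0 (negPf nzq1).
apply: (@val_inj _ _ (ringOfIntegers K)); rewrite rmorph0 -horner_map -qx0.
move: (zprimitive q1) => q; rewrite -map_poly_comp; congr (_.[_]).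
apply: eq_map_poly => z.
by rewrite /comp [LHS](rmorph_int (\val : {rmorphism _ -> _})) [RHS]rmorph_int.
Qed.

(** Once the powers of ['X] are divided out of an annihilator of a nonzero [x] in [P], its constant
    term is a nonzero integer and a multiple of [x]. *)
Lemma nonzero_ideal_nat (K : fieldExtType rat)
    (P : prime_idealr (ringOfIntegers K)) : nonzero_ideal P ->
  exists2 n : nat, (0 < n)%N & n%:R \in P.
Proof.
case=> x xP nzx; have [q [q1 _ qx]] := primitive_annihilator x.
have: q != 0 by apply: contra_eq_neq q1 => ->; rewrite zcontents0.
elim/poly_ind: q qx {q1} => [|q c IHq]; first by rewrite eqxx.
rewrite rmorphD rmorphM /= map_polyX map_polyC /= hornerMXaddC => qx0 nzq.
have [c0|nzc] := eqVneq c 0.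
  apply: IHq; last by apply: contraNneq nzq => ->; rewrite mul0r add0r c0.
  move/(congr1 val): qx0; rewrite c0 addr0 rmorphM rmorph0 => /eqP.
  rewrite mulf_eq0 => /orP[/eqP qx0|/eqP x0]; first exact: val_inj.
  by case/eqP: nzx; apply: val_inj.
exists `|c|%N; first by rewrite absz_gt0.
have cP : c%:~R \in P.
  move/eqP: qx0; rewrite addr_eq0 => /eqP qx0.
  by rewrite -[_%:~R]opprK rpredN -qx0 idealMr.
by move: cP; case: (intP c) => [|n|n] //; rewrite ?rmorphN ?rpredN.
Qed.

(** For the least positive integer [m] in [P], primality of [P] puts [pdiv m] or [m %/ pdiv m] in
    [P], and minimality excludes the latter. *)
Lemma residue_pchar (K : fieldExtType rat)
    (P : prime_idealr (ringOfIntegers K)) : nonzero_ideal P ->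
  exists2 l : nat, prime l & l \in [pchar {ideal_quot P}].
Proof.
move=> /nonzero_ideal_nat[n n_gt0 nP].
have exn : exists n, (0 < n)%N && (n%:R \in P) by exists n; rewrite n_gt0.
case: (ex_minnP exn) => m /andP[m_gt0 mP] m_min {n n_gt0 nP exn}.
have m_gt1 : (1 < m)%N.
  by rewrite ltn_neqAle m_gt0 andbT; apply: contraTneq mP => <-; rewrite idealr1.
have l_pr := pdiv_prime m_gt1; exists (pdiv m) => //.
rewrite inE l_pr -(rmorph_nat (\pi_{ideal_quot P})) /=.
have lP : (pdiv m)%:R \in P.
  move: mP; rewrite -{1}(divnK (pdiv_dvd m)) natrM prime_idealrM => /orP[mlP|//].
  have := m_min (m %/ pdiv m)%N; rewrite mlP andbT divn_gt0 ?prime_gt0 //.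
  by rewrite dvdn_leq ?pdiv_dvd // leqNgt ltn_Pdiv ?prime_gt1 // => /(_ isT).
by rewrite pi_ideal_eq0.
Qed.

Lemma residue_finite (K : fieldExtType rat)
    (P : prime_idealr (ringOfIntegers K)) : nonzero_ideal P ->
  finite_set [set: {ideal_quot P}]%classic.
Proof.
pose T : comNzRingType := {ideal_quot P}.
move=> /residue_pchar[l l_pr lT].
have domT : GRing.integral_domain_axiom T by exact: Quotient.rquot_IdomainAxiom.
have l_gt0 := prime_gt0 l_pr; pose m := (\dim {:K}).+1.
(* A finite family: all polynomials of size at most [m] with coefficients reduced modulo [l]. *)
pose g (f : {ffun 'I_m -> 'I_l}) : {poly T} := \sum_(i < m) (f i)%:R *: 'X^i.
(* The zero polynomial is excluded, since every element is a root of it; its list is an arbitrary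
   default. *)
have /choice[roots rootsP] f : exists s : seq T,
    g f != 0 -> forall x, root (g f) x -> x \in s.
  have [->|nzg] := eqVneq (g f) 0; first by exists [::].
  by have [s sP] := roots_in_seq domT nzg; exists s.
apply: (@sub_finite_set _ _ [set` flatten [seq roots f | f : {ffun 'I_m -> 'I_l}]]%classic);
  last exact: finite_seq.
elim/quotW => y _ /=.
have [q [q1 sq qy0]] := primitive_annihilator y.
have ltl (z : int) : (`|(z %% l)%Z| < l)%N.
  by rewrite -ltz_nat gez0_abs ?modz_ge0 ?ltz_pmod ?eqz_nat -?lt0n.
pose f : {ffun 'I_m -> 'I_l} := [ffun i : 'I_m => Ordinal (ltl q`_i)].
have gE : g f = map_poly intr q.
  transitivity (\poly_(i < m) `|(q`_i %% l)%Z|%:R : {poly T}).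
    by rewrite poly_def; apply: eq_bigr => i _; rewrite ffunE.
  apply/polyP => i; rewrite coef_poly coef_map /=; case: ltnP => [_|mi]; last first.
    by rewrite nth_default ?(leq_trans sq).
  rewrite [in RHS](divz_eq q`_i l) rmorphD rmorphM /= -[l%:~R]/(l%:R).
  rewrite (pcharf0 lT) mulr0 add0r.
  by rewrite -[in RHS](gez0_abs (modz_ge0 _ _)) // eqz_nat -lt0n.
(* Otherwise [l] would divide every coefficient of [q], hence its content, which is 1. *)
have nzg : g f != 0.
  apply: contra_eq_neq q1; rewrite gE => q0; apply: contraTneq l_pr => q1.
  have: (l %| zcontents q)%Z.
    rewrite dvdz_contents; apply/polyOverP => i.
    by rewrite (dvdz_pcharf lT) -coef_map q0 coef0.
  by rewrite q1 dvdz1 => /eqP l1; rewrite -[l]/`|l|%N l1.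
apply/flattenP; exists (roots f); first by apply/mapP; exists f; rewrite ?mem_enum.
apply: rootsP => //; rewrite gE.
pose pi_P : {rmorphism ringOfIntegers K -> T} := \pi_{ideal_quot P}.
rewrite rootE; have /eqP := congr1 pi_P qy0.
rewrite -horner_map -map_poly_comp rmorph0; congr (_.[_] == 0).
by apply: eq_map_poly => z; rewrite /comp [LHS]rmorph_int.
Qed.

(** Multiplication by a nonzero element is injective, hence surjective on a finite set. The field
    [F] is [T] itself with added structure, and the morphism is the identity. *)
Lemma finite_domain_field (T : comNzRingType) :
  GRing.integral_domain_axiom T -> finite_set [set: T]%classic ->
  exists (F : finFieldType) (f : {rmorphism T -> F}),
    injective f /\ #|F| = #|` fset_set [set: T]%classic|%fset.
Proof.
move=> domT finT; pose e := enum_fset (fset_set [set: T]%classic).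
have e_uniq : uniq e by exact: fset_uniq.
have eP x : x \in e.
  have -> : (x \in e) = (x \in [set: T]%classic) := in_fset_set finT x.
  exact: mem_set.
have /choice[inv invP] (x : T) : exists y, if x == 0 then y = 0 else y * x = 1.
  have [_|nzx] := eqVneq x 0; first by exists 0.
  have mulx_inj : injective (fun y => y * x).
    move=> y z /eqP; rewrite -subr_eq0 -mulrBl => /eqP/domT.
    by rewrite (negPf nzx) orbF subr_eq0 => /eqP.
  have := @uniq_min_size _ [seq y * x | y <- e] e.
  rewrite map_inj_uniq // size_map => /(_ e_uniq (fun z _ => eP z) (leqnn _)).
  by case=> _ /(_ 1); rewrite eP => /mapP[y _ ->]; exists y.
have mulVf (x : T) : x != 0 -> inv x * x = 1.
  by move=> nzx; have := invP x; rewrite (negPf nzx).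
have inv0 : inv 0 = 0 by have := invP 0; rewrite eqxx.
have enumP : Finite.axiom e by move=> x; rewrite count_uniq_mem ?eP.
pose fieldT := GRing.ComNzRing_isField.Build T mulVf inv0.
have indexK : pcancel (index^~ e) (fun i => Some (nth 0 e i)).
  by move=> x; rewrite nth_index.
pose countT := isCountable.Build T indexK.
pose finmT := isFinite.Build T enumP.
pose F : finFieldType := HB.pack (GRing.ComNzRing.sort T) fieldT countT finmT.
exists F, (idfun : {rmorphism T -> T}); split; first exact: inj_id.
by rewrite cardE enumT unlock.
Qed.

(** * Vieta's formulas and the trace relation over a finite field *)

Lemma cubic_splits (L : fieldType) (u v : L) (rs : seq L) :
  cubic u v %= \prod_(z <- rs) ('X - z%:P) ->
  exists r1 r2 r3 : L, [/\ rs = [:: r1; r2; r3], r1 + r2 + r3 = 0,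
    u = r1 * r2 + r1 * r3 + r2 * r3 & v = - (r1 * r2 * r3)].
Proof.
rewrite eqp_monic ?monic_cubic ?monic_prod_XsubC // => /eqP Ers.
have := congr1 (fun p : {poly L} => size p) Ers; rewrite size_cubic size_prod_XsubC.
case: rs Ers => [|r1 [|r2 [|r3 [|? ?]]]] // Ers _; exists r1, r2, r3.
have {}Ers : cubic u v = 'X^3 - (r1 + r2 + r3) *: 'X^2
    + (r1 * r2 + r1 * r3 + r2 * r3) *: 'X - (r1 * r2 * r3)%:P.
  by rewrite Ers !big_cons big_nil -!mul_polyC !rmorphD /= !rmorphM; ring.
have coefs i := congr1 (fun p : {poly L} => p`_i) Ers.
move: (coefs 0%N) (coefs 1%N) (coefs 2%N); rewrite /cubic !coefE /=.
rewrite !(mulr0,mulr1,addr0,add0r,subr0,sub0r,oppr0).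
move=> -> -> /esym/eqP; rewrite oppr_eq0 => /eqP.
by split.
Qed.

Lemma pnat_card_finField (F : finFieldType) : [pchar F].-nat #|F|.
Proof.
have [l l_pr lF] := finPcharP F; rewrite (card_pprimeChar lF).
by rewrite (eq_pnat _ (pcharf_eq lF)) pnatX pnat_id.
Qed.

Lemma rmodp_card_trace (R : comNzRingType) (F : finFieldType)
    (f : {rmorphism R -> F}) (u v a b c : R) :
  Pdiv.Ring.rmodp 'X^#|F| (cubic u v) = a *: 'X^2 + b *: 'X + c%:P ->
  f (3%:R * c) = f (2%:R * u * a).
Proof.
move=> remE.
have nzC : cubic (f u) (f v) != 0 by rewrite -size_poly_eq0 size_cubic.
have [L [rs]] := FinSplittingFieldFor nzC; rewrite map_cubic => Ers _.
have [r1 [r2 [r3 [rsE r123 uE vE]]]] := cubic_splits Ers.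
pose g : {rmorphism R -> L} := in_alg L \o f.
have rootq r : r \in rs -> g a * r ^+ 2 + g b * r + g c = r ^+ #|F|.
  move=> rs_r; transitivity (map_poly g (Pdiv.Ring.rmodp 'X^#|F| (cubic u v))).[r].
    rewrite remE !rmorphD /= !map_polyZ map_polyXn map_polyX map_polyC.
    by rewrite !hornerE.
  rewrite horner_rmodp_root ?monic_cubic // ?map_polyXn ?hornerXn //.
  by rewrite map_cubic [root _ _](eqp_root Ers) root_prod_XsubC.
have := trace_quadratic (g a) (g b) (g c) r123; rewrite -uE.
rewrite !rootq ?rsE ?inE ?eqxx ?orbT //.
(* Since [#|F|] is a power of the characteristic, raising to it is additive: the sum of the powers
   of the roots is the power of their sum, which is 0. *)
have Lnat : [pchar L].-nat #|F|.
  by rewrite (eq_pnat _ (pchar_lalg L)) pnat_card_finField.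
rewrite -!exprDn_pchar // r123 expr0n.
have /negPf-> : #|F| != 0%N by rewrite -lt0n; apply/card_gt0P; exists 0.
move=> /esym/eqP; rewrite subr_eq0 => /eqP trE.
apply: (fmorph_inj (in_alg L)); rewrite -[LHS]/(g _) -[RHS]/(g _).
by rewrite !rmorphM !rmorph_nat.
Qed.

(** * Algebraic integers under field morphisms *)

Lemma integers_map_zmod_morphism (F L : fieldType) (h : {rmorphism F -> L}) :
  zmod_morphism (integers_map h).
Proof. by move=> x y; apply: val_inj; rewrite /= rmorphB. Qed.

HB.instance Definition _ (F L : fieldType) (h : {rmorphism F -> L}) :=
  GRing.isZmodMorphism.Build _ _ (integers_map h)
    (integers_map_zmod_morphism h).

Lemma integers_map_monoid_morphism (F L : fieldType) (h : {rmorphism F -> L}) :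
  monoid_morphism (integers_map h).
Proof.
split; first by apply: val_inj; rewrite /= rmorph1.
by move=> x y; apply: val_inj; rewrite /= rmorphM.
Qed.

HB.instance Definition _ (F L : fieldType) (h : {rmorphism F -> L}) :=
  GRing.isMonoidMorphism.Build _ _ (integers_map h)
    (integers_map_monoid_morphism h).

Lemma root_cubic (R : comNzRingType) (u v x : R) :
  root (cubic u v) x = (x ^+ 3 + u * x + v == 0).
Proof. by rewrite /root /cubic !hornerE. Qed.

Lemma cubic_root_integral (F : fieldType) (u v : ringOfIntegers F) (x : F) :
  root (cubic (oval u) (oval v)) x -> x \in algebraic_integer F.
Proof.
move=> rx; apply/asboolP; apply: integral_root_monic (monic_cubic _ _) rx _.
have intP (y : ringOfIntegers F) : integralOver (intr : int -> F) (oval y).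
  exact/asboolP/ovalP.
apply/integral_poly => i; rewrite /cubic !coefE.
case: i => [|[|[|[|i]]]] /=; rewrite ?mulr0 ?mulr1 ?addr0 ?add0r //.
- exact: integral0.
- exact: integral1.
- exact: integral0.
Qed.

(** * Permutations of three points, up to relabelling *)

Section CubicPermutations.
Variables (T : eqType) (g : T -> T) (r1 r2 r3 : T).
Let rs := [:: r1; r2; r3].
Hypotheses (g_inj : injective g) (rs_uniq : uniq rs).
Hypotheses (g_rs : {in rs, forall x, g x \in rs}).
Hypothesis g_moves : ~ {in rs, forall x, g x = x}.

Let images : [/\ [\/ g r1 = r1, g r1 = r2 | g r1 = r3],
  [\/ g r2 = r1, g r2 = r2 | g r2 = r3]
  & [\/ g r3 = r1, g r3 = r2 | g r3 = r3]].
Proof.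
have mem_rs x : x \in rs -> [\/ x = r1, x = r2 | x = r3].
  by rewrite !inE => /or3P[]/eqP; [constructor 1|constructor 2|constructor 3].
by split; apply/mem_rs/g_rs; rewrite !inE eqxx ?orbT.
Qed.

Let neqs : [/\ r1 <> r2, r1 <> r3 & r2 <> r3].
Proof.
move: rs_uniq; rewrite /= !inE negb_or andbT => /andP[/andP[n12 n13] n23].
by split; apply/eqP.
Qed.

Let not_fixed : g r1 = r1 -> g r2 = r2 -> g r3 = r3 -> False.
Proof.
by move=> e1 e2 e3; apply: g_moves => x; rewrite !inE => /or3P[]/eqP->.
Qed.

Lemma swaps_or_cycles : exists x1 x2 x3, perm_eq [:: x1; x2; x3] rs /\
  ([/\ g x1 = x1, g x2 = x3 & g x3 = x2] \/ [/\ g x1 = x2, g x2 = x3 & g x3 = x1]).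
Proof.
have [n12 n13 n23] := neqs.
(* Of the 27 patterns of values, injectivity and [not_fixed] leave the three transpositions and the
   two 3-cycles. *)
have [[] e1 [] e2 [] e3] := images; try by [
  case: not_fixed
| case: n12; apply: g_inj; rewrite e1 e2 | case: n13; apply: g_inj; rewrite e1 e3
| case: n23; apply: g_inj; rewrite e2 e3].
- by exists r1, r2, r3; split; [|left].
- by exists r3, r1, r2; split; [apply/seq.permP => x /=; ring|left].
- by exists r1, r2, r3; split; [|right].
- by exists r1, r3, r2; split; [apply/seq.permP => x /=; ring|right].
- by exists r2, r1, r3; split; [apply/seq.permP => x /=; ring|left].
Qed.

Lemma involution_swaps : {in rs, forall x, g (g x) = x} ->
  exists x1 x2 x3, [/\ perm_eq [:: x1; x2; x3] rs,
    g x1 = x1, g x2 = x3 & g x3 = x2].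
Proof.
move=> gg; have [x1 [x2 [x3 [xrs [[e1 e2 e3]|[e1 e2 _]]]]]] := swaps_or_cycles.
  by exists x1, x2, x3.
have := gg x1; rewrite -(perm_mem xrs) mem_head e1 e2 => /(_ isT) e.
by move: rs_uniq; rewrite -(perm_uniq xrs) e /= !inE eqxx orbT.
Qed.

Lemma order3_cycles : {in rs, forall x, g (g (g x)) = x} ->
  exists x1 x2 x3, [/\ perm_eq [:: x1; x2; x3] rs,
    g x1 = x2, g x2 = x3 & g x3 = x1].
Proof.
move=> ggg; have [x1 [x2 [x3 [xrs [[_ e2 e3]|[e1 e2 e3]]]]]] := swaps_or_cycles.
  have := ggg x2; rewrite -(perm_mem xrs) !inE eqxx orbT e2 e3 e2 => /(_ isT) e.
  by move: rs_uniq; rewrite -(perm_uniq xrs) e /= !inE eqxx andbF.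
by exists x1, x2, x3.
Qed.

End CubicPermutations.

(** * Galois elements and the Frobenius on the roots *)

Lemma gal_fixing_generators (F : fieldType) (E : splittingFieldType F)
    (rs : seq E) (s : gal_of {:E}) :
  <<1 & rs>>%VS = {:E}%VS -> {in rs, forall x, s x = x} -> s = 1%g.
Proof.
move=> genE fix_s; apply/eqP/gal_eqP => x _.
(* The fixed field of [s] contains the generators, hence all of [E]. *)
have: (<<1 & rs>> <= fixedField [set s])%VS.
  apply/Fadjoin_seqP; split=> [|y yrs]; first exact: sub1v.
  by apply/fixedFieldP; rewrite ?memvf // => t /set1P->; exact: fix_s.
rewrite genE gal_id => /subvP/(_ x (memvf x)).
by move=> /(fixedFieldP (memvf x)); apply; rewrite inE.
Qed.

Section FrobeniusOnRoots.
Variables (K : fieldExtType rat) (E : splittingFieldType K).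
Variables (u v : ringOfIntegers K).
Notation A := (ringOfIntegers K).
Notation B := (ringOfIntegers E).
Variable P : prime_idealr A.
Let C := cubic (in_alg E (oval u)) (in_alg E (oval v)).

Lemma gal_cubic_root (s : gal_of {:E}) (x : E) : root C x -> root C (s x).
Proof.
have {2}<- : map_poly s C = C by rewrite map_cubic; congr cubic; exact: rmorph_alg.
by rewrite fmorph_root.
Qed.

(* The residue ring of [Q] receives the values of the integral elements of [E]
   through [t]; on the non-integral ones [t] is [0]. *)
Lemma frobenius_residue (f : nat) (a b c : A) :
  Pdiv.Ring.rmodp 'X^(ideal_norm P) (cubic u v) = a *: 'X^2 + b *: 'X + c%:P ->
  frobenius_primes E (cubic_disc u v) f P ->
  exists (s : gal_of {:E}) (T : comNzRingType) (phi : {rmorphism A -> T})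
    (t : E -> T),
  [/\ #[s]%g = f, GRing.integral_domain_axiom T,
      forall z, (phi z == 0) = (z \in P)
    & forall x1 x2 x3, C %= \prod_(z <- [:: x1; x2; x3]) ('X - z%:P) ->
      [/\ t x1 + t x2 + t x3 = 0,
          phi u = t x1 * t x2 + t x1 * t x3 + t x2 * t x3,
          phi v = - (t x1 * t x2 * t x3)
        & {in [:: x1; x2; x3], forall x,
            phi a * t x ^+ 2 + phi b * t x + phi c = t (s x)}]].
Proof.
move=> remE [_ _ [Q [s [PQ [_ frob_s] ord_s]]]].
pose T : comNzRingType := {ideal_quot Q}.
pose psi : {rmorphism B -> T} := \pi_{ideal_quot Q}.
pose phi : {rmorphism A -> T} := psi \o integers_map (in_alg E).
pose t (x : E) : T := psi (insubd (0 : B) x).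
exists s, T, phi, t; split=> //.
- exact: Quotient.rquot_IdomainAxiom.
- by move=> z; rewrite [LHS]pi_ideal_eq0 PQ.
move=> x1 x2 x3 Ers.
have rootC x : x \in [:: x1; x2; x3] -> root C x.
  by rewrite [root _ _](eqp_root Ers) root_prod_XsubC.
have liftB x : root C x -> {y : B | oval y = x & t x = psi y}.
  move=> rx; have xB : x \in algebraic_integer E.
    exact: (@cubic_root_integral _ (integers_map (in_alg E) u)
                                   (integers_map (in_alg E) v)).
  exists (RingOfIntegers xB) => //; apply: (congr1 psi); apply: val_inj.
  by rewrite val_insubd xB.
have [y1 y1E t1] := liftB x1 (rootC _ (mem_head _ _)).
have [|y2 y2E t2] := liftB x2; first by rewrite rootC ?inE ?eqxx ?orbT.
have [|y3 y3E t3] := liftB x3; first by rewrite rootC ?inE ?eqxx ?orbT.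
have [_ [_ [_ [[<- <- <-] r123 uE vE]]]] := cubic_splits Ers.
rewrite t1 t2 t3 -!rmorphM -!rmorphD -rmorphN; split.
- rewrite -[RHS](rmorph0 psi); apply: (congr1 psi); apply: val_inj.
  by rewrite /= y1E y2E y3E.
- by apply: (congr1 psi); apply: val_inj; rewrite /= y1E y2E y3E -uE.
- by apply: (congr1 psi); apply: val_inj; rewrite /= y1E y2E y3E -vE.
move=> x /rootC rx; have [y yE ->] := liftB x rx.
have [y' y'E ->] := liftB (s x) (gal_cubic_root s rx).
have -> : y' = integers_map s y by apply: val_inj; rewrite /= y'E yE.
(* By the Frobenius congruence the class of [s x] is the [ideal_norm P]-th power of [psi y]; this is
   the value of the remainder there, since [psi y] is a root of the reduced cubic. *)
rewrite [psi (integers_map _ _)]frob_s -[RHS]/(psi _) rmorphXn.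
transitivity (map_poly phi (Pdiv.Ring.rmodp 'X^(ideal_norm P) (cubic u v))).[psi y].
  by rewrite remE !rmorphD /= !map_polyZ map_polyXn map_polyX map_polyC !hornerE.
rewrite horner_rmodp_root ?monic_cubic // ?map_polyXn ?hornerXn //.
have ry0 : y ^+ 3 + integers_map (in_alg E) u * y + integers_map (in_alg E) v = 0.
  by apply: val_inj; move: rx; rewrite root_cubic -yE => /eqP.
rewrite map_cubic root_cubic -(rmorphXn psi) -(rmorphM psi) -!(rmorphD psi) ry0.
by rewrite (rmorph0 psi).
Qed.
End FrobeniusOnRoots.

(** * The congruences modulo [P] *)

Lemma rmorph_cubic_disc (R S : comNzRingType) (f : {rmorphism R -> S}) (u v : R) :
  f (cubic_disc u v) = cubic_disc (f u) (f v).
Proof.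
by rewrite /cubic_disc; ring.
Qed.

Lemma eq0_mod_ideal (R : comNzRingType) (I : idealr R) (x : R) :
  x \in I -> x = 0 %[ mod_ideal I].
Proof. by rewrite -[x \in I]pi_ideal_eq0 => /eqP->; rewrite rmorph0. Qed.

Theorem theorem25 (K : fieldExtType rat) (u v : ringOfIntegers K)
  (C : {poly ringOfIntegers K}) (hC : C = cubic u v)
  (Delta : ringOfIntegers K) (hDelta : Delta = cubic_disc u v)
  (hirr : irreducible_poly (map_poly (@oval K) C))
  (E : splittingFieldType K)
  (hE : splittingFieldFor 1%VS
          (map_poly (in_alg E) (map_poly (@oval K) C)) {:E}%VS)
  (hGal : ('Gal({:E} / 1) \isog [set: 'S_3])%g)
  (hnsq : ~ exists d : ringOfIntegers K, Delta = d ^+ 2)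
  (U : nat -> ringOfIntegers K)
  (hU : forall n : nat, U n.+3 + u * U n.+1 + v * U n = 0)
  (P : prime_idealr (ringOfIntegers K))
  (hP0 : nonzero_ideal P) (hPunr : Delta \notin P)
  (p : nat) (hp : p = ideal_norm P) :
  exists a b c : ringOfIntegers K,
    Pdiv.Ring.rmodp 'X^p C = a *: 'X^2 + b *: 'X + c%:P /\
    U p = a * U 2%N + b * U 1%N + c * U 0%N %[ mod_ideal P] /\
    3%:R * c = 2%:R * u * a %[ mod_ideal P] /\
    (frobenius_primes E Delta 1 P -> U p = U 1%N %[ mod_ideal P]) /\
    (frobenius_primes E Delta 3 P ->
       [/\ Delta * a ^+ 2 - 9%:R * u ^+ 2 = 0 %[ mod_ideal P],
           Delta * (b ^+ 2 + b) - (u ^+ 3 + 27%:R * v ^+ 2) = 0 %[ mod_ideal P]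
         & Delta * c ^+ 2 - 4%:R * u ^+ 4 = 0 %[ mod_ideal P]]) /\
    (frobenius_primes E Delta 2 P ->
       [/\ Delta * a ^+ 3 - 9%:R * u ^+ 2 * a - 27%:R * v = 0 %[ mod_ideal P],
           Delta * b ^+ 3 + 3%:R * u ^+ 3 * b - u ^+ 3 = 0 %[ mod_ideal P]
         & Delta * c ^+ 3 - 4%:R * u ^+ 4 * c - 8%:R * u ^+ 3 * v
             = 0 %[ mod_ideal P]]).
Proof.
rewrite {hirr hGal hnsq}hC hp hDelta in hE hPunr *.
set Rp := Pdiv.Ring.rmodp _ _; pose a := Rp`_2; pose b := Rp`_1; pose c := Rp`_0.
have remE : Rp = a *: 'X^2 + b *: 'X + c%:P.
  apply: poly_size3; rewrite -ltnS -[4%N](size_cubic u v).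
  by rewrite Pdiv.Ring.ltn_rmodpN0 // -size_poly_eq0 size_cubic.
have Up := linear_recurrence_rmodp hU remE.
exists a, b, c; do 2?[split; first by rewrite ?Up]; split.
  (* The residue ring becomes a finite field with [ideal_norm P] elements, so the exponent of ['X]
     is its cardinality. *)
  have domT := @Quotient.rquot_IdomainAxiom _ P.
  have [F [f [f_inj cardF]]] := finite_domain_field domT (residue_finite hP0).
  pose pi_P : {rmorphism ringOfIntegers K -> {ideal_quot P}} := \pi_{ideal_quot P}.
  apply: f_inj; apply: (@rmodp_card_trace _ F (f \o pi_P) u v a b c).
  by rewrite cardF -remE.
have ovalC : map_poly (@oval K) (cubic u v) = cubic (oval u) (oval v).
  exact: (map_cubic (\val : {rmorphism ringOfIntegers K -> K})).
case: hE => rs; rewrite ovalC map_cubic => Crs genE.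
have [r1 [r2 [r3 [rsE r123 uE vE]]]] := cubic_splits Crs.
(* The discriminant lies outside [P], so it is nonzero, and in [E] it is the square of the product
   of the root differences. *)
have rs_uniq : uniq rs.
  have : in_alg E (oval (cubic_disc u v)) != 0.
    rewrite fmorph_eq0; apply: contraNneq hPunr => D0.
    suff -> : cubic_disc u v = 0 by rewrite rpred0.
    exact: (@val_inj _ _ (ringOfIntegers K)).
  have -> : oval (cubic_disc u v) = cubic_disc (oval u) (oval v).
    exact: (rmorph_cubic_disc (\val : {rmorphism ringOfIntegers K -> K})).
  rewrite rmorph_cubic_disc uE vE cubic_disc_vandermonde //.
  rewrite expf_eq0 /= !mulf_eq0 !negb_or !subr_eq0 => /andP[/andP[n12 n13] n23].
  by rewrite rsE /= !inE negb_or n12 n13 n23.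
have s_rs (s : gal_of {:E}) : {in rs, forall x, s x \in rs}.
  move=> x; rewrite -!root_prod_XsubC -!(eqp_root Crs).
  exact: gal_cubic_root.
have s_moves (s : gal_of {:E}) : (1 < #[s])%g%N -> ~ {in rs, forall x, s x = x}.
  by move=> s_gt1 /(gal_fixing_generators genE) s1; rewrite s1 order1 in s_gt1.
have s_expg (s : gal_of {:E}) x n : (s ^+ n)%g x = iter n s x.
  elim: n => [|n IHn]; first by rewrite expg0 gal_id.
  by rewrite expgSr galM ?memvf // IHn.
have Cperm x1 x2 x3 : perm_eq [:: x1; x2; x3] rs ->
    cubic (in_alg E (oval u)) (in_alg E (oval v))
      %= \prod_(z <- [:: x1; x2; x3]) ('X - z%:P).
  by move=> xrs; rewrite (perm_big _ xrs).
have frob := frobenius_residue remE; split=> [/frob|].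
  case=> s [T [phi [t [/eqP s1 domT kerphi tP]]]].
  move: s1; rewrite order_eq1 => /eqP s1.
  rewrite rsE in Crs; have [t123 uT vT qt] := tP _ _ _ Crs.
  have tfix x : x \in [:: r1; r2; r3] -> phi a * t x ^+ 2 + phi b * t x + phi c = t x.
    by move=> /qt->; rewrite s1 gal_id.
  have [||||a0 b1 c0] := quadratic_fixing_roots domT (a := phi a) (b := phi b)
    (c := phi c) (r1 := t r1) (r2 := t r2) (r3 := t r3).
  (* The square of the Vandermonde product of the [t ri] is the image of the discriminant under
     [phi], whose kernel is [P]. *)
  - apply: contraNneq hPunr => V0; rewrite -kerphi rmorph_cubic_disc uT vT.
    by rewrite cubic_disc_vandermonde // V0 expr0n.
  - by rewrite tfix ?mem_head.
  - by rewrite tfix // !inE eqxx orbT.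
  - by rewrite tfix // !inE eqxx !orbT.
  apply/eqP; rewrite -Quotient.idealrBE -kerphi Up; apply/eqP.
  by rewrite !(rmorphB, rmorphD, rmorphM) a0 b1 c0 !mul0r mul1r addr0 add0r subrr.
split=> /frob[s [T [phi [t [ord_s domT kerphi tP]]]]].
all: have kerP z : phi z = 0 -> z = 0 %[ mod_ideal P]
  by move=> z0; apply: eq0_mod_ideal; rewrite -kerphi z0.
all: have moves := s_moves s; rewrite ord_s in moves.
(* With the order of [s] known, this gives the relation [g (g (g x)) = x] or [g (g x) = x] that
   selects the cycle or the swap. *)
all: have sX x : iter #[s]%g s x = x by rewrite -s_expg expg_order gal_id.
all: rewrite ord_s /= in sX.
all: rewrite rsE in moves rs_uniq s_rs Cperm.
- have [x1 [x2 [x3 [xrs e1 e2 e3]]]] := order3_cycles (@fmorph_inj _ _ s) rs_uniq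
    (s_rs s) (moves isT) (fun x _ => sX x).
  have [t123 uT vT qt] := tP _ _ _ (Cperm _ _ _ xrs).
  have [] := quadratic_cycling_roots (a := phi a) (b := phi b) (c := phi c) t123.
  + by rewrite qt ?mem_head // e1.
  + by rewrite qt ?e2 // !inE eqxx orbT.
  + by rewrite qt ?e3 // !inE eqxx !orbT.
  rewrite -uT -vT -rmorph_cubic_disc => ea eb ec; split; apply: kerP.
  + by rewrite -[RHS]ea; ring.
  + by rewrite -[RHS]eb; ring.
  + by rewrite -[RHS]ec; ring.
- have [x1 [x2 [x3 [xrs e1 e2 e3]]]] := involution_swaps (@fmorph_inj _ _ s) rs_uniq
    (s_rs s) (moves isT) (fun x _ => sX x).
  have [t123 uT vT qt] := tP _ _ _ (Cperm _ _ _ xrs).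
  have [] := quadratic_swapping_roots (a := phi a) (b := phi b) (c := phi c) domT t123.
  (* If the two swapped roots had the same residue, the discriminant would lie in [P]. *)
  + apply: contraNneq hPunr => t23; rewrite -kerphi rmorph_cubic_disc uT vT.
    by rewrite cubic_disc_vandermonde // t23 mulr0 expr0n.
  + by rewrite qt ?mem_head // e1.
  + by rewrite qt ?e2 // !inE eqxx orbT.
  + by rewrite qt ?e3 // !inE eqxx !orbT.
  rewrite -uT -vT -rmorph_cubic_disc => ea eb ec; split; apply: kerP.
  + by rewrite -[RHS]ea; ring.
  + by rewrite -[RHS]eb; ring.
  + by rewrite -[RHS]ec; ring.
Qed.
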